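(* If a (Krasner) hyperring $R$ is Noetherian, then the hyperstructure space $\mathtt{Prim}(R)$ is a Noetherian topological space.
   Context: For a nonempty set $H$, $\mathcal P^*(H)$ is the set of nonempty subsets of $H$. A canonical hypergroup $(H,+,0)$ is a nonempty set $H$ with a hyperoperation $+\colon H\times H\to\mathcal P^*(H)$ and $0\in H$ (with $A+B=\bigcup_{a\in A,b\in B}(a+b)$ for subsets, and elements identified with singletons) such that for all $a,b,c\in H$: $a+b=b+a$; $a+(b+c)=(a+b)+c$; $a+0=\{a\}$; there is a unique $-a\in H$ with $0\in a-a:=a+(-a)$; and $a\in b+c$ implies $c\in -b+a$ and $b\in a-c$. A (Krasner) hyperring $R$ is a canonical hypergroup $(R,+,0)$ with an associative binary (single-valued) multiplication such that $a0=0a=0$, $a(b+c)=ab+ac$, $(a+b)c=ac+bc$; a multiplicative identity and commutativity are not assumed. A subhypergroup is a nonempty subset $S$ with $x-y\subseteq S$ for all $x,y\in S$. A hyperideal of $R$ is a (two-sided) subhypergroup $\mathfrak a$ with $ra\in\mathfrak a$ and $ar\in\mathfrak a$ for all $r\in R$, $a\in\mathfrak a$. $R$ is Noetherian if it satisfies the ascending chain condition on hyperideals. A (right) $R$-hypermodule is a canonical hypergroup $M$ with a map $M\times R\to M$, $(m,r)\mapsto mr$, such that $(m+m')r=mr+m'r$, $m(r+r')=mr+mr'$, $m(rr')=(mr)r'$, $m0=0$. A subhypermodule is a subhypergroup $S$ of $M$ with $sr\in S$ for all $s\in S$, $r\in R$. $M$ is simple if $MR\neq 0$ (i.e. $mr\ne0$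 for some $m\in M,r\in R$) and its only subhypermodules are $0$ and $M$. $\mathtt{Ann}_R(M)=\{r\in R\mid mr=0\text{ for all }m\in M\}$. A proper hyperideal of $R$ is primitive if it equals $\mathtt{Ann}_R(M)$ for some simple $R$-hypermodule $M$; $\mathtt{Prim}(R)$ is the set of primitive hyperideals. The hyperstructure space is $\mathtt{Prim}(R)$ with the topology (Jacobson topology) given by the closure operator $\mathtt{Cl}(S)=\{\mathfrak p\in\mathtt{Prim}(R)\mid \mathfrak p\supseteq\mathcal K_S\}$, $\mathcal K_S=\bigcap_{\mathfrak q\in S}\mathfrak q$ (with $\mathcal K_\emptyset=R$). A topological space is Noetherian if its closed subsets satisfy the descending chain condition. *)

(* Defs.v *)
From HB Require Import structures.
From mathcomp Require Import all_boot.
From mathcomp Require Import boolp classical_sets functions topology.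

Set Implicit Arguments.
Unset Strict Implicit.
Unset Printing Implicit Defensive.

Local Open Scope classical_set_scope.

(* Extension of a hyperoperation to subsets. *)
Definition hyperop_set (H : Type) (op : H -> H -> set H) (A B : set H) : set H :=
  \bigcup_(a in A) \bigcup_(b in B) op a b.

(* The carrier is nonempty because of [hzero]; [hopp_uniq] is the uniqueness of
   the element -a such that 0 \in a + (-a). *)
HB.mixin Record isCanonicalHypergroup (H : Type) := {
  hadd : H -> H -> set H;
  hzero : H;
  hopp : H -> H;
  hadd_neq0 : forall a b, hadd a b !=set0;
  haddC : forall a b, hadd a b = hadd b a;
  haddA : forall a b c,
    hyperop_set hadd [set a] (hadd b c) = hyperop_set hadd (hadd a b) [set c];
  hadd0 : forall a, hadd a hzero = [set a];
  haddN : forall a, hadd a (hopp a) hzero;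
  hopp_uniq : forall a b, hadd a b hzero -> b = hopp a;
  hadd_rev : forall a b c,
    hadd b c a -> hadd (hopp b) a c /\ hadd a (hopp c) b
}.

#[short(type="canonicalHypergroupType")]
HB.structure Definition CanonicalHypergroup := { H of isCanonicalHypergroup H }.

HB.mixin Record CanonicalHypergroup_isHyperring R & CanonicalHypergroup R := {
  hmul : R -> R -> R;
  hmulA : forall a b c : R, hmul a (hmul b c) = hmul (hmul a b) c;
  hmulr0 : forall a : R, hmul a hzero = hzero;
  hmul0r : forall a : R, hmul hzero a = hzero;
  hmulDr : forall a b c : R,
    [set hmul a x | x in hadd b c] = hadd (hmul a b) (hmul a c);
  hmulDl : forall a b c : R,
    [set hmul x c | x in hadd a b] = hadd (hmul a c) (hmul b c)
}.

(* Neither commutativity nor a multiplicative identity is required. *)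
#[short(type="hyperringType")]
HB.structure Definition Hyperring :=
  { R of CanonicalHypergroup R & CanonicalHypergroup_isHyperring R }.

HB.mixin Record CanonicalHypergroup_isHypermodule (R : hyperringType) M
    & CanonicalHypergroup M := {
  hact : M -> R -> M;
  hactDl : forall (m m' : M) (r : R),
    [set hact x r | x in hadd m m'] = hadd (hact m r) (hact m' r);
  hactDr : forall (m : M) (r r' : R),
    [set hact m x | x in hadd r r'] = hadd (hact m r) (hact m r');
  hactA : forall (m : M) (r r' : R), hact m (hmul r r') = hact (hact m r) r';
  hact0 : forall m : M, hact m hzero = hzero
}.

#[short(type="hypermoduleType")]
HB.structure Definition Hypermodule (R : hyperringType) :=
  { M of CanonicalHypergroup M & CanonicalHypergroup_isHypermodule R M }.

(* Besides being the basic example, the regular hypermodule forces the universe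
   of hypermodules to be at least as large as that of hyperrings, so that
   [primitive] below does not miss hypermodules of the size of [R]. *)
Definition regular_hypermodule (R : hyperringType) : Type := R.

HB.instance Definition _ (R : hyperringType) :=
  CanonicalHypergroup.copy (regular_hypermodule R) R.
HB.instance Definition _ (R : hyperringType) :=
  CanonicalHypergroup_isHypermodule.Build R (regular_hypermodule R)
    (@hmulDl R) (@hmulDr R) (@hmulA R) (@hmulr0 R).

Definition subhypergroup (H : canonicalHypergroupType) (S : set H) : Prop :=
  S !=set0 /\ forall x y, S x -> S y -> hadd x (hopp y) `<=` S.

Definition hyperideal (R : hyperringType) (I : set R) : Prop :=
  subhypergroup I /\ forall r a, I a -> I (hmul r a) /\ I (hmul a r).

Definition noetherian_hyperring (R : hyperringType) : Prop :=
  forall I : nat -> set R,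
    (forall n, hyperideal (I n)) -> (forall n, I n `<=` I n.+1) ->
    exists N, forall n, N <= n -> I n = I N.

Definition subhypermodule (R : hyperringType) (M : hypermoduleType R)
    (S : set M) : Prop :=
  subhypergroup S /\ forall s (r : R), S s -> S (hact s r).

Definition simple_hypermodule (R : hyperringType) (M : hypermoduleType R) : Prop :=
  (exists (m : M) (r : R), hact m r <> hzero) /\
  forall S : set M, subhypermodule S -> S = [set hzero] \/ S = setT.

Definition Ann (R : hyperringType) (M : hypermoduleType R) : set R :=
  [set r | forall m : M, hact m r = hzero].

Definition primitive (R : hyperringType) (p : set R) : Prop :=
  [/\ hyperideal p, p <> setT &
      exists M : hypermoduleType R, simple_hypermodule M /\ p = Ann M].

Record Prim (R : hyperringType) := MkPrim {
  prim_set :> set R;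
  prim_primitive : primitive prim_set
}.

(* The intersection over the empty family is [setT]. *)
Definition hkernel (R : hyperringType) (S : set (Prim R)) : set R :=
  \bigcap_(q in S) (q : set R).

Definition jacobson_closure (R : hyperringType) (S : set (Prim R)) : set (Prim R) :=
  [set p : Prim R | hkernel S `<=` p].

Definition jacobson_open (R : hyperringType) (A : set (Prim R)) : Prop :=
  jacobson_closure (~` A) = ~` A.

Lemma hact0l (R : hyperringType) (M : hypermoduleType R) (r : R) :
  hact (hzero : M) r = hzero.
Proof.
by rewrite -[X in hact X r](@hact0 R M hzero) -hactA hmul0r hact0.
Qed.

Lemma hactNl (R : hyperringType) (M : hypermoduleType R) (m : M) (r : R) :
  hact (hopp m) r = hopp (hact m r).
Proof.
apply: hopp_uniq; rewrite -hactDl; exists hzero; first exact: haddN.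
exact: hact0l.
Qed.

Lemma hopp0 (H : canonicalHypergroupType) : hopp (hzero : H) = hzero.
Proof. by symmetry; apply: hopp_uniq; rewrite hadd0. Qed.

Lemma primitive_prime (R : hyperringType) (p I J : set R) :
  primitive p -> hyperideal I -> hyperideal J ->
  I `&` J `<=` p -> I `<=` p \/ J `<=` p.
Proof.
move=> [_ _ [M [[_ simM] ->]]] [_ idI] [_ idJ] IJ.
pose N := [set m : M | forall a, I a -> hact m a = hzero].
have subN : subhypermodule N.
  split.
    split; first by exists hzero => a _; exact: hact0l.
    move=> x y Nx Ny z zxy a Ia.
    have : [set hact w a | w in hadd x (hopp y)] (hact z a) by exists z.
    by rewrite hactDl hactNl Nx // Ny // hopp0 hadd0.
  by move=> s r Ns a Ia; rewrite -hactA; apply: Ns; have [] := idI r a Ia.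
case: (simM N subN) => [N0|NT]; last first.
  by left => a Ia m; have : N m by [rewrite NT]; apply.
right => r Jr m.
suff : N (hact m r) by rewrite N0.
move=> a Ia; rewrite -hactA; apply: (IJ (hmul r a)); split.
- by have [] := idI r a Ia.
- by have [] := idJ a r Jr.
Qed.

Lemma hyperideal0 (R : hyperringType) (I : set R) : hyperideal I -> I hzero.
Proof. by move=> [[[x Ix] IB] _]; apply: (IB x x Ix Ix); exact: haddN. Qed.

Lemma hyperideal_hkernel (R : hyperringType) (S : set (Prim R)) :
  hyperideal (hkernel S).
Proof.
split; first split.
- by exists hzero => q _; have [/hyperideal0] := prim_primitive q.
- move=> x y Sx Sy z xyz q Sq.
  have [[[_ qB] _] _ _] := prim_primitive q.
  by apply: (qB x y) => //; [exact: Sx|exact: Sy].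
- move=> r a Sa; split=> q Sq; have [[_ qM] _ _] := prim_primitive q;
    by have [] := qM r a (Sa q Sq).
Qed.

Lemma hkernelS (R : hyperringType) (S T : set (Prim R)) :
  S `<=` T -> hkernel T `<=` hkernel S.
Proof. by move=> ST r Tr q /ST; exact: Tr. Qed.

Lemma jacobson_closureS (R : hyperringType) (S T : set (Prim R)) :
  S `<=` T -> jacobson_closure S `<=` jacobson_closure T.
Proof. by move=> ST p; apply: subset_trans; exact: hkernelS. Qed.

Lemma jacobson_closure_sub (R : hyperringType) (S : set (Prim R)) :
  S `<=` jacobson_closure S.
Proof. by move=> p Sp r; apply. Qed.

Lemma jacobson_closureK (R : hyperringType) (S : set (Prim R)) :
  jacobson_closure (jacobson_closure S) = jacobson_closure S.
Proof.
apply/seteqP; split; last exact: jacobson_closure_sub.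
by move=> p; apply: subset_trans => r Sr q; apply.
Qed.

Lemma jacobson_closure0 (R : hyperringType) :
  jacobson_closure (set0 : set (Prim R)) = set0.
Proof.
apply/seteqP; split=> // p p0; have [_ pT _] := prim_primitive p.
by apply: pT; apply/seteqP; split=> // r _; apply: p0.
Qed.

Lemma jacobson_closureU (R : hyperringType) (S T : set (Prim R)) :
  jacobson_closure (S `|` T) = jacobson_closure S `|` jacobson_closure T.
Proof.
apply/seteqP; split=> p.
- move=> STp; apply: (primitive_prime (prim_primitive p));
    [exact: hyperideal_hkernel|exact: hyperideal_hkernel|].
  by move=> r [Sr Tr]; apply: STp => q [Sq|Tq]; [exact: Sr|exact: Tr].
- by case; apply: jacobson_closureS => q; [left|right].
Qed.

Lemma jacobson_openT (R : hyperringType) : jacobson_open (setT : set (Prim R)).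
Proof. by rewrite /jacobson_open setCT jacobson_closure0. Qed.

Lemma jacobson_openI (R : hyperringType) : setI_closed (@jacobson_open R).
Proof.
by move=> A B oA oB; rewrite /jacobson_open setCI jacobson_closureU oA oB.
Qed.

Lemma jacobson_open_bigU (R : hyperringType) (I : Type) (f : I -> set (Prim R)) :
  (forall i, jacobson_open (f i)) -> jacobson_open (\bigcup_i f i).
Proof.
move=> fo; apply/seteqP; split; last exact: jacobson_closure_sub.
rewrite setC_bigcup => p cp i _; rewrite -(fo i).
by apply: jacobson_closureS cp => q; apply.
Qed.

HB.instance Definition _ (R : hyperringType) := gen_eqMixin (Prim R).
HB.instance Definition _ (R : hyperringType) := gen_choiceMixin (Prim R).
HB.instance Definition _ (R : hyperringType) :=
  isOpenTopological.Build (Prim R)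
    (@jacobson_openT R) (@jacobson_openI R) (@jacobson_open_bigU R).

Lemma closure_Prim (R : hyperringType) (S : set (Prim R)) :
  closure S = jacobson_closure S.
Proof.
have clP (A : set (Prim R)) : closed A <-> jacobson_closure A = A.
  by rewrite -openC -{2 3}(setCK A).
apply/seteqP; split.
- rewrite closureE; apply: smallest_sub; last exact: jacobson_closure_sub.
  by apply/clP; exact: jacobson_closureK.
- have /clP <- := @closed_closure _ S.
  by apply: jacobson_closureS; exact: subset_closure.
Qed.

Definition noetherian_space (T : topologicalType) : Prop :=
  forall F : nat -> set T,
    (forall n, closed (F n)) -> (forall n, F n.+1 `<=` F n) ->
    exists N, forall n, N <= n -> F n = F N.

(* Main.v *)
(* Closed sets are recovered from their kernels, and taking kernels reverses
   inclusion, so a descending chain of closed sets is controlled by the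
   ascending chain of its kernels. *)
Require Import Defs.
From mathcomp Require Import all_boot.
From mathcomp Require Import boolp classical_sets functions topology.

(** A closed set consists of all primitive hyperideals containing its kernel, so [hkernel] is
    injective on closed sets. Once the ascending chain of kernels is stationary, so is the chain of
    closed sets. *)

Lemma closed_hkernel_inj (R : hyperringType) (A B : set (Prim R)) :
  closed A -> closed B -> hkernel A = hkernel B -> A = B.
Proof.
move=> /closure_id clA /closure_id clB eqK.
(* The closure of a set depends on that set only through its [hkernel]. *)
by rewrite clA clB !closure_Prim /jacobson_closure eqK.
Qed.

Theorem proposition4p7 (R : hyperringType) (hR : noetherian_hyperring R) :
  noetherian_space (Prim R).
Proof.
move=> F clF decF.
have [|n|N stab] := hR (fun n => hkernel (F n)).
- by move=> n; exact: hyperideal_hkernel.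
- exact/hkernelS/decF.
(* [stab] equates only the kernels; injectivity lifts this to the closed sets. *)
by exists N => n /stab; exact: closed_hkernel_inj.
Qed.
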